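(* Let $3<p<\infty$ and $\frac1p+\frac1q=1$. Let $\mathcal J:l_p\to l_q$ be the mapping $\mathcal J(x)=(|t_1|^{p-1}\mathrm{sign}(t_1),|t_2|^{p-1}\mathrm{sign}(t_2),\dots)$ for $x=(t_1,t_2,\dots)\in l_p$. Let $\bar x=\{\bar t_n\}_{n=1}^\infty\in l_p$ and $\bar y\in l_q$ with $\mathcal J(\bar x)=\bar y$. Then the covering constant for $\mathcal J$ at $(\bar x,\bar y)$ satisfies $$\hat\alpha(\mathcal J,\bar x,\bar y)=0.$$
   Context: $(l_p,\|\cdot\|_p)$ and $(l_q,\|\cdot\|_q)$ are the real sequence spaces, $l_p^*=l_q$, $l_q^*=l_p$, and $\langle\cdot,\cdot\rangle$ is the canonical real pairing $\sum_n a_nb_n$ of elements of $l_q$ and $l_p$. The Mordukhovich derivative (Fréchet coderivative) of $\mathcal J$ at $(x,y)$, $y=\mathcal J(x)$, is the set-valued map $\widehat D^*\mathcal J(x,y):l_p\rightrightarrows l_q$, $$\widehat D^*\mathcal J(x,y)(w)=\left\{z\in l_q:\limsup_{u\to x,\,u\in l_p}\frac{\langle z,u-x\rangle-\langle w,\mathcal J(u)-\mathcal J(x)\rangle}{\|u-x\|_p+\|\mathcal J(u)-\mathcal J(x)\|_q}\le0\right\},\quad w\in l_p.$$ The covering constant for $\mathcal J$ at $(\bar x,\bar y)$, $\bar y=\mathcal J(\bar x)$, is $$\hat\alpha(\mathcal J,\bar x,\bar y)=\sup_{\eta>0}\inf\left\{\|z\|_q:\ z\in\widehat D^*\mathcal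 J(x,y)(w),\ x\in\mathbb B_{l_p}(\bar x,\eta),\ y=\mathcal J(x)\in\mathbb B_{l_q}(\bar y,\eta),\ \|w\|_p=1\right\},$$ where $\mathbb B_X(a,\eta)$ is the closed ball in $X$ with center $a$ and radius $\eta$. *)

(* Defs.v *)
From HB Require Import structures.
From mathcomp Require Import all_boot all_order all_algebra.
From mathcomp Require Import all_classical all_reals all_analysis.
Import Order.TTheory GRing.Theory Num.Theory.
Import numFieldNormedType.Exports.

Set Implicit Arguments.
Unset Strict Implicit.
Unset Printing Implicit Defensive.

Local Open Scope classical_set_scope.
Local Open Scope ring_scope.

Section sequence_space.
Context {R : realType} {p : R}.

(* The counting measure on nat has no nonempty null set, so no quotient is
   needed: l_p is the type of p-summable functions nat -> R itself. *)
Definition ell (p1 : (1 <= p%:E)%E) : Type := LfunType (@counting nat R) p1.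

Variable p1 : (1 <= p%:E)%E.

HB.instance Definition _ := GRing.Lmodule.copy (ell p1)
  (LfunType (@counting nat R) p1).

Definition ell_fun (x : ell p1) : nat -> R := x : LfunType (@counting nat R) p1.

Definition ell_norm (x : ell p1) : R :=
  fine ('N[@counting nat R]_p%:E[EFin \o ell_fun x])%E.

Lemma ell_ler_normD (x y : ell p1) : ell_norm (x + y) <= ell_norm x + ell_norm y.
Proof. exact: ler_LnormD. Qed.

Lemma ell_normrZ (a : R) (x : ell p1) : ell_norm (a *: x) = `|a| * ell_norm x.
Proof.
by apply: EFin_inj; rewrite EFinM !finite_norm_fine -LnormZ.
Qed.

Lemma ell_normr0_eq0 (x : ell p1) : ell_norm x = 0 -> x = 0.
Proof.
move=> /fine_Lnormr_eq0[A [_ A0 sub]]; apply/LfuneqP => n.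
apply: contrapT => xn; have An : A n by apply: sub => /= /(_ I).
have /(le_measure (@counting nat R)) : [set n] `<=` A by move=> _ ->.
rewrite !inE => /(_ I I); rewrite [leRHS]A0 /= /counting asboolT ?finite_set1//.
by rewrite fset_set1 finmap.cardfs1 lee_fin ler10.
Qed.

HB.instance Definition _ := @Lmodule_isNormed.Build R (ell p1)
  ell_norm ell_ler_normD ell_normrZ ell_normr0_eq0.

Lemma ell_normE (x : ell p1) :
  `|x| = fine ((\sum_(k <oo) (`|ell_fun x k| `^ p)%:E) `^ p^-1)%E.
Proof.
have p0 : 0 < p by move: p1; rewrite lee_fin; exact: lt_le_trans.
by rewrite [LHS]/(ell_norm x) /ell_norm Lnorm_counting.
Qed.

End sequence_space.
Coercion ell_fun : ell >-> Funclass.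

Section conjugate_exponents.
Context {R : realType}.
Variables p q : R.

Lemma gt1_lee : 1 < p -> (1 <= p%:E)%E.
Proof. by move=> p1; rewrite lee_fin ltW. Qed.

Lemma gt3_gt1 : 3 < p -> 1 < p.
Proof. by apply: lt_trans; rewrite ltr1n. Qed.

Lemma conj_gt1 : 1 < p -> p^-1 + q^-1 = 1 -> 1 < q.
Proof.
move=> p1 pq; have p0 : 0 < p by exact: lt_trans p1.
have qE : q^-1 = 1 - p^-1 by rewrite -pq addrAC subrr add0r.
have q0 : 0 < q by rewrite -invr_gt0 qE subr_gt0 invf_lt1.
have : q^-1 < 1 by rewrite qE gtrBl invr_gt0.
by rewrite invf_lt1.
Qed.

End conjugate_exponents.

Section duality_mapping.
Context {R : realType} {p q : R}.
Hypotheses (p1 : 1 < p) (pq : p^-1 + q^-1 = 1).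

Local Notation lp := (ell (gt1_lee p1)).
Local Notation lq := (ell (gt1_lee (conj_gt1 p1 pq))).

Definition Jseq (x : nat -> R) (n : nat) : R :=
  `|x n| `^ (p - 1) * Num.sg (x n).

Lemma Jseq_Lfun (x : lp) : Jseq x \in Lfun (@counting nat R) q%:E.
Proof.
have q1 := conj_gt1 p1 pq.
have p0 : 0 < p by exact: lt_trans p1.
have q0 : 0 < q by exact: lt_trans q1.
have pqE : (p - 1) * q = p.
  have : (p^-1 + q^-1) * (p * q) = p * q by rewrite pq mul1r.
  rewrite mulrDl mulrA mulVf ?gt_eqF// mul1r mulrCA mulVf ?gt_eqF// mulr1.
  by move=> pqs; rewrite mulrBl mul1r -pqs addrAC subrr add0r.
rewrite inE; apply/andP; split; rewrite inE//=.
rewrite /finite_norm Lnorm_counting//=; apply: poweR_lty.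
have -> : (\sum_(k <oo) (`|Jseq x k| `^ q)%:E =
           \sum_(k <oo) (`|ell_fun x k| `^ p)%:E)%E.
  apply: eq_eseriesr => k _; congr (_%:E); rewrite /Jseq.
  have [->|xk0] := eqVneq (ell_fun x k) 0.
    by rewrite sgr0 mulr0 normr0 !powR0 ?gt_eqF.
  rewrite normrM normr_sg xk0 mulr1 (ger0_norm (powR_ge0 _ _)).
  by rewrite -powRrM pqE.
have := @Lfunction_finite _ _ _ _ _ (gt1_lee p1) x.
rewrite /finite_norm Lnorm_counting//= => /lty_poweRy; apply.
by rewrite gt_eqF// invr_gt0.
Qed.

Definition J (x : lp) : lq :=
  Lfun_Sub (gt1_lee (conj_gt1 p1 pq)) (Jseq_Lfun x).

Lemma JE (x : lp) n : J x n = `|x n| `^ (p - 1) * Num.sg (x n).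
Proof. by []. Qed.

End duality_mapping.
Arguments J {R p q} p1 pq x.

Section pairing.
Context {R : realType} {p q : R}.
Context {p1 : (1 <= p%:E)%E} {q1 : (1 <= q%:E)%E}.

Definition pairing (a : ell p1) (b : ell q1) : R :=
  limn (series (fun n => a n * b n)).

Lemma is_cvg_pairing (a : ell p1) (b : ell q1) : p^-1 + q^-1 = 1 ->
  cvgn (series (fun n => a n * b n)).
Proof.
move=> pq; apply: normed_cvg => /=.
have p0 : 0 < p by move: p1; rewrite lee_fin; exact: lt_le_trans.
have q0 : 0 < q by move: q1; rewrite lee_fin; exact: lt_le_trans.
have fin r (r1 : (1 <= r%:E)%E) (x : ell r1) :
    'N[@counting nat R]_r%:E[EFin \o x]%E \is a fin_num.
  by rewrite ge0_fin_numE ?Lnorm_ge0//; exact: Lfunction_finite.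
have := @hoelder _ nat R counting a b p q.
move=> /(_ ltac:(done) ltac:(done) p0 q0 pq) hold.
have {hold} : ('N[@counting nat R]_1[EFin \o (a \* b)%R] < +oo)%E.
  by apply: le_lt_trans hold _; rewrite ltey_eq fin_numM ?fin.
rewrite Lnorm_counting// invr1 poweRe1; last first.
  by apply: nneseries_ge0 => n _ _; exact: poweR_ge0.
set S := (X in (X < _)%E) => Sfin.
have Sge n : ((series (fun k => `|a k * b k|) n)%:E <= S)%E.
  rewrite /series /= -sumEFin; apply: le_trans (nneseries_lim_ge n _) => /=.
    by apply: lee_sum => k _; rewrite powRr1.
  by move=> k _ _; rewrite lee_fin powR_ge0.
apply: nondecreasing_is_cvgn.
  by apply: nondecreasing_series => k _ _; exact: normr_ge0.
exists (fine S) => _ [n _ <-]; rewrite -lee_fin fineK ?Sge//.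
by rewrite ge0_fin_numE// (le_trans _ (Sge 0%N))// lee_fin /series /= big_geq.
Qed.

End pairing.

Section coderivative.
Context {R : realType} {p q : R}.
Context {p1 : (1 <= p%:E)%E} {q1 : (1 <= q%:E)%E}.
Variable f : ell p1 -> ell q1.

(* Coderivative of the single-valued map f at the graph point (x, f x);
   z lives in l_q = (l_p)^* and w in l_p = (l_q)^*. *)
Definition coderivative (x w : ell p1) : set (ell q1) :=
  [set z : ell q1 |
    (limf_esup (fun u : ell p1 =>
       ((pairing z (u - x) - pairing w (f u - f x)) /
        (`|u - x| + `|f u - f x|))%:E) x^' <= 0)%E].

Definition covering_constant (xbar : ell p1) (ybar : ell q1) : \bar R :=
  ereal_sup [set
    ereal_inf [set `|z|%:E | z in [set z : ell q1 |
      exists x w : ell p1,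
        [/\ coderivative x w z, closed_ball xbar eta x,
            closed_ball ybar eta (f x) & `|w| = 1]]]
    | eta in [set eta : R | 0 < eta]].

End coderivative.

(* Main.v *)
Require Import Defs.
From mathcomp Require Import all_boot all_order all_algebra.
From mathcomp Require Import all_classical all_reals all_analysis.
Import Order.TTheory GRing.Theory Num.Theory.
Import numFieldNormedType.Exports.
Local Open Scope ring_scope.

(** The [n]-th coordinate of [J] is [t |-> |t|^(p-1) sign t], which is flat at
    [t = 0]: at a point [x] with [x n = 0] one has
    [|J u n| = |u n|^(p-1) <= `|u - x| ^ (p-1)], and this is [o(`|u - x|)]
    because [p - 1 > 1]. Hence [z = 0] belongs to the coderivative
    of [J] at [x] in the direction [w] of the [n]-th unit vector
    ([coderivative_J_spike]).

    Points with a vanishing coordinate are dense, even along the graph of [J]: since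
    the coordinates of a point [xbar] of l_p take arbitrarily small absolute
    values, erasing a small one moves both [xbar] and [J xbar] by as little as
    desired ([J_zero_coord_near]). So for every radius the infimum defining
    the covering constant is attained at [z = 0], and the supremum of these
    infima is 0. *)

(** * Coordinates of elements of l_p *)

Section ell_coordinates.
Context {R : realType} {p : R} {p1 : (1 <= p%:E)%E}.
Implicit Types (x : ell p1) (n : nat) (c : R).

Let p_gt0 : 0 < p.
Proof. by move: p1; rewrite lee_fin; exact: lt_le_trans. Qed.

Let p_neq0 : p != 0. Proof. by rewrite gt_eqF. Qed.

Lemma ell_sum_lty x : (\sum_(k <oo) (`|x k| `^ p)%:E < +oo)%E.
Proof.
have := @Lfunction_finite _ _ _ _ _ p1 x.
rewrite /finite_norm Lnorm_counting// => /lty_poweRy; apply.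
by rewrite invr_neq0.
Qed.

Lemma ell_norm_poweR x : (`|x|%:E = (\sum_(k <oo) (`|x k| `^ p)%:E) `^ p^-1)%E.
Proof.
rewrite ell_normE fineK// ge0_fin_numE ?poweR_ge0//.
exact/poweR_lty/ell_sum_lty.
Qed.

Lemma ell_coord_le_norm x n : `|x n| <= `|x|.
Proof.
rewrite -lee_fin ell_norm_poweR.
have S0 k : (0 <= (`|x k| `^ p)%:E)%E by rewrite lee_fin powR_ge0.
rewrite -[`|x n|]powRr1// -(divff p_neq0) powRrM -poweR_EFin.
apply: (gt0_ler_poweR (r := p^-1)); rewrite ?invr_ge0 ?(ltW p_gt0)//.
- by rewrite in_itv/= S0 leey.
- by rewrite in_itv/= leey andbT nneseries_ge0.
by rewrite (nneseriesD1 (n := n))// leeDl// nneseries_ge0.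
Qed.

Lemma ell_norm_single x n : (forall k, k != n -> x k = 0) -> `|x| = `|x n|.
Proof.
move=> x0; apply: EFin_inj; rewrite ell_norm_poweR.
rewrite (nneseriesD1 (n := n))//.
rewrite eseries0 ?adde0; last first.
  by move=> k _ /= kn; rewrite x0// normr0 powR0.
by rewrite poweR_EFin -powRrM divff// powRr1.
Qed.

(** If [d <= |x n|] for all [n], the [N]-th partial sum of the series of
    [|x n|^p] would be at least [N * d^p], which is unbounded. *)
Lemma ell_coord_small x (d : R) : 0 < d -> exists n, `|x n| < d.
Proof.
move=> d0; apply: contrapT => /forallNP xd.
have dp0 : 0 < d `^ p by rewrite powR_gt0.
have S0 k : (0 <= (`|x k| `^ p)%:E)%E by rewrite lee_fin powR_ge0.
have := ell_sum_lty x; set S := (X in (X < _)%E) => Sfin.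
have Sge N : ((d `^ p *+ N)%:E <= S)%E.
  apply: le_trans (nneseries_lim_ge N _) => //.
  rewrite sumEFin lee_fin big_mkord -[N in leLHS]card_ord -sumr_const.
  apply: ler_sum => k _; have /negP := xd k; rewrite -leNgt => dx.
  by apply: ge0_ler_powR => //; rewrite ?nnegrE ?ltW.
have {}Sge N : d `^ p *+ N <= fine S.
  by rewrite -lee_fin fineK// ge0_fin_numE// nneseries_ge0.
have := Sge (Num.bound (fine S / d `^ p)).
rewrite leNgt -mulr_natl -ltr_pdivrMr// => /negP; apply.
by apply: archi_boundP; rewrite divr_ge0 ?powR_ge0// (le_trans _ (Sge 0%N)).
Qed.

Lemma spike_Lfun n c :
  (fun k => if k == n then c else 0) \in Lfun (@counting nat R) p%:E.
Proof.
rewrite inE; apply/andP; split; rewrite inE//=.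
rewrite /finite_norm Lnorm_counting//; apply: poweR_lty.
rewrite (nneseriesD1 (n := n))//; last by move=> k _; rewrite poweR_ge0.
rewrite eseries0 ?adde0/= ?eqxx ?ltry//.
by move=> k _ /= /negbTE ->; rewrite normr0 powR0.
Qed.

Definition spike n c : ell p1 := Lfun_Sub p1 (spike_Lfun n c).

Lemma spikeE n c k : spike n c k = if k == n then c else 0.
Proof. by []. Qed.

Lemma spike_norm n c : `|spike n c| = `|c|.
Proof.
by rewrite (@ell_norm_single _ n) ?spikeE ?eqxx// => k /negbTE kn; rewrite spikeE kn.
Qed.

(** Subtraction in l_p is pointwise; [ell_fun] is explicit on the left because
    the difference would otherwise be coerced to a function through the type
    of p-integrable functions underlying l_p. *)
Lemma ellBE (x y : ell p1) k : ell_fun (x - y) k = x k - y k.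
Proof. by []. Qed.

End ell_coordinates.

(** * Pairing with zero and with unit vectors *)

Section pairing_lemmas.
Context {R : realType} {p q : R}.
Context {p1 : (1 <= p%:E)%E} {q1 : (1 <= q%:E)%E}.

Lemma pairing0l (b : ell q1) : pairing (0 : ell p1) b = 0.
Proof.
rewrite /pairing (_ : series _ = fun=> 0) ?lim_cst//.
by apply/funext => n; rewrite /series/= big1// => k _; rewrite [X in X * _](_ : _ = 0) ?mul0r.
Qed.

Lemma pairing_spikel n c (b : ell q1) : pairing (spike n c : ell p1) b = c * b n.
Proof.
apply: lim_near_cst => //; near=> N.
rewrite /series/= big_mkord.
have nN : (n < N)%N by near: N; exact: nbhs_infty_gt.
rewrite (bigD1 (Ordinal nN))//= eqxx big1 ?addr0// => k.
by rewrite -val_eqE/= => /negbTE ->; rewrite mul0r.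
Unshelve. all: by end_near. Qed.

End pairing_lemmas.

(** * The coderivative of the duality mapping *)

Section covering_constant_J.
Context {R : realType} {p q : R}.
Hypotheses (p1 : 1 < p) (pq : p^-1 + q^-1 = 1).

Lemma norm_JE (x : ell (gt1_lee p1)) n : `|J p1 pq x n| = `|x n| `^ (p - 1).
Proof.
rewrite JE; have [->|xn0] := eqVneq (x n) 0.
  by rewrite sgr0 mulr0 normr0 powR0// subr_eq0 gt_eqF.
by rewrite normrM normr_sg xn0 mulr1 ger0_norm ?powR_ge0.
Qed.

Lemma J_coord0 (x : ell (gt1_lee p1)) n : x n = 0 -> J p1 pq x n = 0.
Proof. by rewrite JE => ->; rewrite sgr0 mulr0. Qed.

(** With [h = `|u - x|], the difference quotient is at most
    [h^(p-1) / h = h^(p-2)], which tends to 0 with [h]. *)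
Lemma coderivative_J_spike (x : ell (gt1_lee p1)) n : 2 < p -> x n = 0 ->
  coderivative (J p1 pq) x (spike n 1) 0.
Proof.
move=> p2 xn0; have r0 : 0 < p - 2 by rewrite subr_gt0.
apply/lee_addgt0Pr => e e0; rewrite add0e.
(* The largest radius on which [h^(p-2) <= e]. *)
set d := e `^ (p - 2)^-1; have d0 : 0 < d by rewrite powR_gt0.
have small (h : R) : 0 < h -> h < d -> h `^ (p - 1) <= e * h.
  move=> h0 hd; have -> : p - 1 = p - 2 + 1 by rewrite -[2]/(1 + 1) opprD addrA subrK.
  rewrite powRD ?(gt_eqF h0) ?implybT// powRr1 ?(ltW h0)//.
  rewrite ler_wpM2r ?(ltW h0)// (@le_trans _ _ (d `^ (p - 2)))//.
    by apply: ge0_ler_powR; rewrite ?nnegrE ?ltW.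
  by rewrite /d -powRrM mulVf ?gt_eqF// powRr1 ?(ltW e0).
rewrite limf_esupE; apply: le_trans (ereal_inf_lbound _) _.
  exists (ball x d `\ x)%classic; last by reflexivity.
  rewrite /dnbhs /within/=; near=> u => ux; split; last exact/eqP.
  by near: u; exact: nbhsx_ballx.
apply: ge_ereal_sup => _ [u [xu /eqP ux] <-].
have h0 : 0 < `|u - x| by rewrite normr_gt0 subr_eq0.
have hd : `|u - x| < d by move: xu; rewrite -ball_normE/= distrC.
rewrite lee_fin pairing0l sub0r pairing_spikel mul1r ellBE (J_coord0 x n xn0) subr0.
rewrite ler_pdivrMr ?ltr_wpDr//.
rewrite (le_trans (ler_norm _))// normrN norm_JE.
have uxn : `|u n| <= `|u - x| by rewrite -[u n]subr0 -xn0 -ellBE ell_coord_le_norm.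
apply: (@le_trans _ _ (`|u - x| `^ (p - 1))).
  by apply: ge0_ler_powR; rewrite ?nnegrE// subr_ge0 ltW.
by rewrite (le_trans (small _ h0 hd))// ler_pM2l// lerDl.
Unshelve. all: by end_near. Qed.

(** Erase a coordinate of [xbar] of absolute value less than [min 1 eta]: both
    [xbar - x] and [J xbar - J x] then vanish outside that coordinate. The bound
    by 1 makes [|xbar n|^(p-1) <= |xbar n|], so that one choice of [n] serves for
    both balls. *)
Lemma J_zero_coord_near (xbar : ell (gt1_lee p1)) (eta : R) : 2 < p -> 0 < eta ->
  exists (x : ell (gt1_lee p1)) n,
    [/\ x n = 0, ball xbar eta x & ball (J p1 pq xbar) eta (J p1 pq x)].
Proof.
move=> p2 eta0.
have [|n] := ell_coord_small xbar (Num.min 1 eta); first by rewrite lt_min ltr01.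
rewrite lt_min => /andP[xn1 xneta].
have x0 : ell_fun (xbar - spike n (xbar n)) n = 0.
  by rewrite ellBE spikeE eqxx subrr.
exists (xbar - spike n (xbar n)), n; split=> //.
- by rewrite -ball_normE/= opprB addrC subrK spike_norm.
rewrite -ball_normE/= (@ell_norm_single _ _ _ _ n) => [|k /negbTE kn]; last first.
  by rewrite ellBE !JE ellBE spikeE kn subr0 subrr.
rewrite ellBE (J_coord0 _ _ x0) subr0 norm_JE.
apply: le_lt_trans xneta.
have [->|xn0] := eqVneq (xbar n) 0; first by rewrite normr0 powR0// subr_eq0 gt_eqF.
by rewrite ge1r_powR ?normr_gt0 ?xn0 ?(ltW xn1)// lerBrDr ltW.
Qed.

Lemma covering_constant_J (xbar : ell (gt1_lee p1)) : 2 < p ->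
  covering_constant (J p1 pq) xbar (J p1 pq xbar) = 0%E.
Proof.
move=> p2; apply/eqP; rewrite eq_le; apply/andP; split.
  apply: ge_ereal_sup => _ [eta eta0 <-].
  have [x [n [xn0 xball Jball]]] := J_zero_coord_near xbar eta p2 eta0.
  apply: ereal_inf_lbound; exists 0; last by rewrite normr0.
  exists x, (spike n 1); split; [|exact: subset_closed_ball..|].
  - exact: coderivative_J_spike.
  - by rewrite spike_norm normr1.
apply: le_trans _ (ereal_sup_ubound _); last first.
  by exists 1; [exact: ltr01|reflexivity].
by apply: le_ereal_inf_tmp => _ [z _ <-]; rewrite lee_fin.
Qed.

End covering_constant_J.

Theorem theorem6p4 (R : realType) (p q : R) (p3 : 3 < p)
    (pq : p^-1 + q^-1 = 1)
    (xbar : ell (gt1_lee (gt3_gt1 p3)))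
    (ybar : ell (gt1_lee (conj_gt1 (gt3_gt1 p3) pq)))
    (Jxy : J (gt3_gt1 p3) pq xbar = ybar) :
  covering_constant (J (gt3_gt1 p3) pq) xbar ybar = 0%E.
Proof.
have p2 : 2 < p by rewrite (lt_trans _ p3) ?ltr_nat.
by rewrite -Jxy covering_constant_J.
Qed.
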